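(* Let $k$ be an infinite field, $n\ge1$ an integer, $q=(q_{ij})$ a multiplicatively antisymmetric $n\times n$ matrix over $k^\times$, $L=k_q[[x_1^{\pm1},\ldots,x_n^{\pm1}]]$ the $q$-commutative Laurent series ring, and let the torus $H=(k^\times)^n$ act on $L$ by $h.x^s=h_1^{s_1}\cdots h_n^{s_n}x^s$. (i) Every $H$-orbit of prime ideals in $L$ is Zariski dense in $\operatorname{Spec}L$. (ii) The Jacobson radical of $L$ is $0$.
   Context: Multiplicatively antisymmetric means $q_{ii}=1$ and $q_{ij}=q_{ji}^{-1}\in k^\times$ for all $i,j$. Let $R=k_q[[x_1,\ldots,x_n]]$ be the associative unital $k$-algebra of formal skew power series $\sum_{s\in\mathbb{N}^n} c_s x^s$ ($c_s\in k$, $x^s=x_1^{s_1}\cdots x_n^{s_n}$, $\mathbb{N}$ the non-negative integers), with multiplication determined by $x_ix_j=q_{ij}x_jx_i$. It is a noetherian domain and each $x_i$ is normal. The ring $L$ is the Ore localization of $R$ at the multiplicatively closed set generated by $1,x_1,\ldots,x_n$; its elements are the series $\sum_{s\in\mathbb{Z}^n}c_sx^s$, $c_s\in k$, with $c_s=0$ for $\min\{s_1,\ldots,s_n\}\ll0$. The action of $h=(h_1,\ldots,h_n)\in H$ on monomials extends linearly and continuously (i.e. coefficientwise) to $k$-algebra automorphisms of $R$, and then to $L$, inducing an action on $\operatorname{Spec}L$, the set of prime ideals of $L$ with the Zariski topology. *)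

(* Defs.v *)
From HB Require Import structures.
From mathcomp Require Import all_boot all_order all_algebra finmap.
From mathcomp Require Import all_classical topology.
From mathcomp Require Import ring zify.

Set Implicit Arguments.
Unset Strict Implicit.
Unset Printing Implicit Defensive.

Import Order.TTheory GRing.Theory Num.Theory.
Local Open Scope classical_set_scope.
Local Open Scope ring_scope.

Section NoncommutativeIdeals.
Context {R : nzRingType}.
Implicit Types (I J M P : set R).

Definition left_ideal I :=
  [/\ I 0, forall a b, I a -> I b -> I (a + b) & forall r a, I a -> I (r * a)].

Definition ideal I := left_ideal I /\ (forall a r, I a -> I (a * r)).

(* As P is closed under addition, the inclusion of the ideal product I J in P
   only has to be tested on the products a * b. *)
Definition prime_ideal P :=
  [/\ ideal P, P <> setT &
      forall I J, ideal I -> ideal J ->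
        (forall a b, I a -> J b -> P (a * b)) -> I `<=` P \/ J `<=` P].

Definition maximal_left_ideal M :=
  [/\ left_ideal M, M <> setT &
      forall I, left_ideal I -> M `<=` I -> I = M \/ I = setT].

End NoncommutativeIdeals.

Definition jacobson_radical (R : nzRingType) : set R :=
  \bigcap_(M in maximal_left_ideal) M.
Arguments jacobson_radical R : clear implicits.

Record spec (R : nzRingType) := Spec {
  spec_ideal :> set R;
  specP : prime_ideal spec_ideal
}.

Lemma spec_inj (R : nzRingType) (P Q : spec R) :
  spec_ideal P = spec_ideal Q -> P = Q.
Proof.
by case: P Q => [P Pp] [Q Qp] /= PQ; case: _ / PQ in Qp *; congr Spec; apply: Prop_irrelevance.
Qed.

HB.instance Definition _ (R : nzRingType) := gen_eqMixin (spec R).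
HB.instance Definition _ (R : nzRingType) := gen_choiceMixin (spec R).

Section Zariski.
Context {R : nzRingType}.

Definition zariski_closed_set (I : set R) : set (spec R) :=
  [set P | I `<=` spec_ideal P].

Definition zariski_open (U : set (spec R)) :=
  exists2 I : set R, ideal I & U = ~` zariski_closed_set I.

Let zariski_openT : zariski_open setT.
Proof.
exists setT; first by do !split.
apply/esym/seteqP; split=> // P _ /= TP.
by case: (specP P) => _ + _; apply; apply/seteqP; split.
Qed.

Let zariski_openI : setI_closed zariski_open.
Proof.
move=> _ _ [I Ii ->] [J Ji ->]; exists (I `&` J).
  case: Ii => -[I0 ID IM] Ir; case: Ji => -[J0 JD JM] Jr.
  split; first split=> //.
  - by move=> a b [? ?] [? ?]; split; [apply: ID|apply: JD].
  - by move=> a b [? ?]; split; [apply: IM|apply: JM].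
  - by move=> a b [? ?]; split; [apply: Ir|apply: Jr].
rewrite -setCU; congr (~` _); apply/seteqP; split=> P /=.
  by case=> sP x [Ix Jx]; apply: sP.
move=> sP; case: (specP P) => _ _ /(_ I J Ii Ji); apply => a b Ia Jb.
apply: sP; split.
  by case: Ii => _; apply.
by case: Ji => -[_ _ +] _; apply.
Qed.

Let zariski_open_bigU (T : Type) (F : T -> set (spec R)) :
  (forall i, zariski_open (F i)) -> zariski_open (\bigcup_i F i).
Proof.
move=> /(_ _)/cid2-/all_sig2[I Ii FE].
exists (\bigcap_(K in [set K | ideal K /\ forall i, I i `<=` K]) K).
  do !split.
  - by move=> K [[[]]].
  - move=> a b Ia Ib K KK; case: (KK) => -[[_ + _] _] _; apply.
      exact: Ia.
    exact: Ib.
  - by move=> r a Ia K KK; case: (KK) => -[[_ _ +] _] _; apply; apply: Ia.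
  - by move=> a r Ia K KK; case: (KK) => -[_ +] _; apply; apply: Ia.
apply/seteqP; split=> P /=.
  move=> [i _]; rewrite FE => nIP sP; apply: nIP => x Ix; apply: sP => K [_].
  by apply; exact: Ix.
apply: contra_notP => nP x; apply; split; first by case: (specP P).
move=> i y Iiy; apply: contrapT => nPy; apply: nP; exists i => //.
by rewrite FE => /(_ _ Iiy).
Qed.

HB.instance Definition _ := isOpenTopological.Build (spec R)
  zariski_openT zariski_openI zariski_open_bigU.

End Zariski.

Lemma prime_ideal_image (R S : nzRingType) (f : {rmorphism R -> S}) (P : set R) :
  bijective f -> prime_ideal P -> prime_ideal (f @` P).
Proof.
move=> bf; have fI : injective f := bij_inj bf.
case: bf => g fg gf [[[P0 PD PM] Pr] PT Pp].
have mP a : (f @` P) (f a) -> P a by case=> b Pb /fI <-.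
split; first split; first split.
- by exists 0; rewrite ?rmorph0.
- by move=> _ _ [a Pa <-] [b Pb <-]; exists (a + b); rewrite ?rmorphD//; apply: PD.
- move=> r _ [a Pa <-]; exists (g r * a); first exact: PM.
  by rewrite rmorphM gf.
- move=> _ r [a Pa <-]; exists (a * g r); first exact: Pr.
  by rewrite rmorphM gf.
- move=> fT; apply: PT; apply/seteqP; split=> // a _; apply: mP.
  by rewrite fT.
have pre (I : set S) : ideal I -> ideal (f @^-1` I).
  move=> [[I0 ID IM] Ir]; split; first split; rewrite /preimage /=.
  - by rewrite rmorph0.
  - by move=> a b Ia Ib; rewrite rmorphD; apply: ID.
  - by move=> a b Ia; rewrite rmorphM; apply: IM.
  - by move=> a b Ia; rewrite rmorphM; apply: Ir.
move=> I J Ii Ji IJ.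
have fIJ a b : (f @^-1` I) a -> (f @^-1` J) b -> P (a * b).
  by move=> Ia Jb; apply: mP; rewrite rmorphM; apply: IJ.
have [sI|sJ] := Pp _ _ (pre _ Ii) (pre _ Ji) fIJ.
- by left=> x Ix; exists (g x); rewrite ?gf//; apply: sI; rewrite /preimage /= gf.
- by right=> x Ix; exists (g x); rewrite ?gf//; apply: sJ; rewrite /preimage /= gf.
Qed.

Definition mult_antisymmetric (k : fieldType) (n : nat) (q : 'M[k]_n) :=
  (forall i, q i i = 1) /\
  (forall i j, q i j != 0 /\ q i j = (q j i)^-1).

(* Exponents s in Z^n are row vectors, s_i being s 0 i. The unused parameter hq
   carries q, on which the ring structure put on this type depends. *)
Record laurent (k : fieldType) (n : nat) (q : 'M[k]_n)
    (hq : mult_antisymmetric q) := Laurent {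
  coef :> 'rV[int]_n -> k;
  coef_bounded : exists m : int, forall (s : 'rV[int]_n) (i : 'I_n),
    s 0 i < m -> coef s = 0
}.

Section LaurentRing.
Context {k : fieldType} {n : nat} {q : 'M[k]_n} {hq : mult_antisymmetric q}.
Notation L := (laurent hq).
Implicit Types (f g h : L) (s t u : 'rV[int]_n).

Lemma laurentP f g : (forall s, f s = g s) -> f = g.
Proof.
case: f g => [f fb] [g gb] /= /funext fg; case: _ / fg in gb *.
by congr Laurent; apply: Prop_irrelevance.
Qed.

HB.instance Definition _ := gen_eqMixin L.
HB.instance Definition _ := gen_choiceMixin L.

Lemma coef_bounded2 f g : exists m : int, forall s i,
  s 0 i < m -> f s = 0 /\ g s = 0.
Proof.
have [a fa] := coef_bounded f; have [b gb] := coef_bounded g.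
exists (Num.min a b) => s i; rewrite lt_min => /andP[sa sb].
by split; [apply: fa sa|apply: gb sb].
Qed.

Let zero_bounded : exists m : int, forall s (i : 'I_n),
  s 0 i < m -> (fun=> 0 : k) s = 0.
Proof. by exists 0. Qed.
Definition laurent_zero : L := Laurent hq zero_bounded.

Let opp_bounded f : exists m : int, forall s (i : 'I_n),
  s 0 i < m -> (fun s => - f s) s = 0.
Proof.
by have [m fm] := coef_bounded f; exists m => s i /fm ->; rewrite oppr0.
Qed.
Definition laurent_opp f : L := Laurent hq (opp_bounded f).

Let add_bounded f g : exists m : int, forall s (i : 'I_n),
  s 0 i < m -> (fun s => f s + g s) s = 0.
Proof.
by have [m fm] := coef_bounded2 f g; exists m => s i /fm[-> ->]; rewrite addr0.
Qed.
Definition laurent_add f g : L := Laurent hq (add_bounded f g).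

Let scale_bounded (a : k) f : exists m : int, forall s (i : 'I_n),
  s 0 i < m -> (fun s => a * f s) s = 0.
Proof.
by have [m fm] := coef_bounded f; exists m => s i /fm ->; rewrite mulr0.
Qed.
Definition laurent_scale a f : L := Laurent hq (scale_bounded a f).

Let addA : associative laurent_add.
Proof. by move=> f g h; apply: laurentP => s /=; rewrite addrA. Qed.
Let addC : commutative laurent_add.
Proof. by move=> f g; apply: laurentP => s /=; rewrite addrC. Qed.
Let add0 : left_id laurent_zero laurent_add.
Proof. by move=> f; apply: laurentP => s /=; rewrite add0r. Qed.
Let addN : left_inverse laurent_zero laurent_opp laurent_add.
Proof. by move=> f; apply: laurentP => s /=; rewrite addNr. Qed.

HB.instance Definition _ := GRing.isZmodule.Build L addA addC add0 addN.

Let scaleA a b f : laurent_scale a (laurent_scale b f) = laurent_scale (a * b) f.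
Proof. by apply: laurentP => s /=; rewrite mulrA. Qed.
Let scale1 : left_id 1 laurent_scale.
Proof. by move=> f; apply: laurentP => s /=; rewrite mul1r. Qed.
Let scaleDr : right_distributive laurent_scale +%R.
Proof. by move=> a f g; apply: laurentP => s /=; rewrite mulrDr. Qed.
Let scaleDl f : {morph laurent_scale^~ f : a b / a + b}.
Proof. by move=> a b; apply: laurentP => s /=; rewrite mulrDl. Qed.

HB.instance Definition _ :=
  GRing.Zmodule_isLmodule.Build k L scaleA scale1 scaleDr scaleDl.

Let monomial_bounded (s : 'rV[int]_n) : exists m : int, forall t (i : 'I_n),
  t 0 i < m -> (fun t => (t == s)%:R : k) t = 0.
Proof.
exists (- \sum_j `|s 0 j|) => t i /= tm; case: eqP => // ts; exfalso.
move: tm; rewrite ts ltNge => /negP; apply.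
rewrite lerNl (bigD1 i) //= -[leLHS]addr0 lerD //; last exact: sumr_ge0.
by rewrite -normrN ler_norm.
Qed.
Definition monomial s : L := Laurent hq (monomial_bounded s).

(* x^s x^t = mono_twist s t x^(s + t): each x_j of x^t is moved to the left of
   the x_i of x^s with j < i. *)
Definition mono_twist s t : k :=
  \prod_(i < n) \prod_(j < n | (j < i)%N) q i j ^ (s 0 i * t 0 j).

(* The sum over all of Z^n has finite support. *)
Definition mul_coef f g u : k :=
  \sum_(s \in [set: 'rV[int]_n]) mono_twist s (u - s) * (f s * g (u - s)).

Lemma mono_twistDl s s' t :
  mono_twist (s + s') t = mono_twist s t * mono_twist s' t.
Proof.
rewrite -big_split; apply: eq_bigr => i _; rewrite -big_split; apply: eq_bigr => j _.
by rewrite mxE mulrDl expfzDr //; case: (hq.2 i j).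
Qed.

Lemma mono_twistDr s t t' :
  mono_twist s (t + t') = mono_twist s t * mono_twist s t'.
Proof.
rewrite -big_split; apply: eq_bigr => i _; rewrite -big_split; apply: eq_bigr => j _.
by rewrite mxE mulrDr expfzDr //; case: (hq.2 i j).
Qed.

Lemma mono_twist0l t : mono_twist 0 t = 1.
Proof.
by rewrite /mono_twist big1 // => i _; rewrite big1 // => j _; rewrite mxE mul0r expr0z.
Qed.

Lemma mono_twist0r s : mono_twist s 0 = 1.
Proof.
by rewrite /mono_twist big1 // => i _; rewrite big1 // => j _; rewrite mxE mulr0 expr0z.
Qed.

Lemma box_finite (a b : int) :
  finite_set [set s : 'rV[int]_n | forall i, a <= s 0 i <= b].
Proof.
pose N := `|b - a|%N.+1.
pose F (e : {ffun 'I_n -> 'I_N}) : 'rV[int]_n := \row_i (a + (e i)%:Z).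
apply: (@sub_finite_set _ _ (F @` setT)); last exact/finite_image/finite_finset.
move=> s /= sab; exists [ffun i : 'I_n => inord (absz (s 0 i - a)%R)] => //.
apply/rowP => i; rewrite mxE ffunE inordK.
  by have /andP[as_ _] := sab i; rewrite gez0_abs ?subr_ge0 // addrC subrK.
have /andP[as_ sb] := sab i.
by rewrite ltnS -lez_nat !gez0_abs ?subr_ge0 ?(le_trans as_) // lerD2r.
Qed.

Lemma conv_finite (m1 m2 : int) (F : 'rV[int]_n -> k) u :
  (forall s i, s 0 i < m1 -> F s = 0) ->
  (forall s i, (u - s) 0 i < m2 -> F s = 0) ->
  finite_set (F @^-1` [set~ 0]).
Proof.
move=> F1 F2.
apply: (sub_finite_set _ (box_finite m1 (\sum_i `|u 0 i| - m2))) => s /= Fs i.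
apply/andP; split.
  by rewrite leNgt; apply/negP => /F1.
rewrite leNgt; apply/negP => sm; apply: Fs; apply: (F2 s i).
rewrite !mxE ltrBlDr -ltrBlDl (le_lt_trans _ sm) // lerD2r (le_trans (ler_norm _)) //.
by rewrite (bigD1 i) //= lerDl sumr_ge0.
Qed.

Lemma mul_coef_finite f g u :
  finite_set ((fun s => mono_twist s (u - s) * (f s * g (u - s))) @^-1` [set~ 0]).
Proof.
have [m fm] := coef_bounded2 f g; apply: (@conv_finite m m _ u) => s i /fm[f0 g0].
  by rewrite f0 mul0r mulr0.
by rewrite g0 !mulr0.
Qed.

Let mul_bounded f g : exists m : int, forall u (i : 'I_n),
  u 0 i < m -> mul_coef f g u = 0.
Proof.
have [m fm] := coef_bounded2 f g; exists (m + m) => u i um.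
apply: fsbig1 => s _; have [/fm[-> _]|ms] := ltP (s 0 i) m.
  by rewrite mul0r mulr0.
have /fm[_ ->] : (u - s) 0 i < m; last by rewrite !mulr0.
by rewrite !mxE ltrBlDr (lt_le_trans um) // lerD2l.
Qed.
Definition laurent_mul f g : L := Laurent hq (mul_bounded f g).

Lemma fsumT_supp (F : 'rV[int]_n -> k) (A : {fset 'rV[int]_n}) :
  (forall s, s \notin A -> F s = 0) ->
  \sum_(s \in [set: 'rV[int]_n]) F s = \sum_(s <- A) F s.
Proof. exact: fsbigTE. Qed.

Lemma fsumTD (F G : 'rV[int]_n -> k) :
  finite_set (F @^-1` [set~ 0]) -> finite_set (G @^-1` [set~ 0]) ->
  \sum_(s \in [set: 'rV[int]_n]) (F s + G s) =
  \sum_(s \in [set: 'rV[int]_n]) F s + \sum_(s \in [set: 'rV[int]_n]) G s.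
Proof.
move=> Ff Gf; pose A := (fset_set (F @^-1` [set~ 0]) `|` fset_set (G @^-1` [set~ 0]))%fset.
have A0 s : s \notin A -> F s = 0 /\ G s = 0.
  rewrite in_fsetU negb_or !in_fset_set // => /andP[].
  by rewrite -!in_setC !in_setE => /contrapT Fs /contrapT Gs.
rewrite !(@fsumT_supp _ A) ?big_split // => s /A0[F0 G0] //.
by rewrite F0 G0 addr0.
Qed.

Let mulDl : left_distributive laurent_mul +%R.
Proof.
move=> f g h; apply: laurentP => u /=; rewrite /mul_coef -fsumTD.
- by apply: eq_fsbigr => s _ /=; rewrite mulrDl mulrDr.
- exact: mul_coef_finite.
- exact: mul_coef_finite.
Qed.

Let mulDr : right_distributive laurent_mul +%R.
Proof.
move=> f g h; apply: laurentP => u /=; rewrite /mul_coef -fsumTD.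
- by apply: eq_fsbigr => s _ /=; rewrite !mulrDr.
- exact: mul_coef_finite.
- exact: mul_coef_finite.
Qed.

Lemma fsumT_only (F : 'rV[int]_n -> k) t :
  (forall s, s != t -> F s = 0) -> \sum_(s \in [set: 'rV[int]_n]) F s = F t.
Proof.
move=> F0; rewrite (@fsumT_supp _ [fset t]%fset) ?big_seq_fset1 // => s.
by rewrite inE => /F0.
Qed.

Let mul1 : left_id (monomial 0) laurent_mul.
Proof.
move=> f; apply: laurentP => u /=; rewrite /mul_coef (@fsumT_only _ 0) => [|s /negPf s0].
  by rewrite mono_twist0l /= eqxx !mul1r subr0.
by rewrite /= s0 mul0r mulr0.
Qed.

Let mulr1' : right_id (monomial 0) laurent_mul.
Proof.
move=> f; apply: laurentP => u /=; rewrite /mul_coef (@fsumT_only _ u) => [|s su].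
  by rewrite /= subrr mono_twist0r eqxx mulr1 mul1r.
by rewrite /= subr_eq0 eq_sym (negPf su) !mulr0.
Qed.

Lemma mono_twistA s w u :
  mono_twist s (u - s) * mono_twist (w - s) (u - w) =
  mono_twist s (w - s) * mono_twist w (u - w).
Proof.
have -> : u - s = (u - w) + (w - s) by rewrite addrA subrK.
have -> : mono_twist w (u - w) = mono_twist (w - s) (u - w) * mono_twist s (u - w).
  by rewrite -mono_twistDl subrK.
by rewrite mono_twistDr; ring.
Qed.

Let mulA : associative laurent_mul.
Proof.
move=> f g h; apply: laurentP => u /=.
pose F s w := mono_twist s (w - s) * mono_twist w (u - w) *
  (f s * g (w - s) * h (u - w)).
transitivity (\sum_(s \in [set: 'rV[int]_n]) \sum_(w \in [set: 'rV[int]_n]) F s w).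
  apply: eq_fsbigr => s _ /=; rewrite /mul_coef mulrA mulr_fsumr.
  rewrite (@reindex_fsbigT _ _ _ _ _ (fun w => w - s)); last first.
    by exists (fun w => w + s) => w; rewrite ?subrK ?addrK.
  apply: eq_fsbigr => w _; have -> : u - s - (w - s) = u - w.
    by rewrite opprB addrA subrK.
  by rewrite /F -mono_twistA; ring.
have [m fm] := coef_bounded2 f g; have [p hp] := coef_bounded h.
pose a := Num.min (Num.min m p) 0.
have am : a <= m by rewrite /a !ge_min lexx.
have ap : a <= p by rewrite /a !ge_min lexx orbT.
have a0 : a <= 0 by rewrite /a !ge_min lexx orbT.
clearbody a; pose A := fset_set [set s : 'rV[int]_n |
  forall i, a + a <= s 0 i <= \sum_i `|u 0 i| - (a + a)].
have FA s w : s \notin A \/ w \notin A -> F s w = 0.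
  have F0 i : F s w != 0 -> [/\ a <= s 0 i, a <= (w - s) 0 i & a <= (u - w) 0 i].
    move=> Fsw; split; rewrite leNgt; apply: contra_neqN Fsw => lta.
    - by have [f0 _] := fm _ _ (lt_le_trans lta am); rewrite /F f0 !mul0r mulr0.
    - by have [_ g0] := fm _ _ (lt_le_trans lta am); rewrite /F g0 mulr0 mul0r mulr0.
    - by have h0 := hp _ _ (lt_le_trans lta ap); rewrite /F h0 !mulr0.
  move=> sw; apply/eqP; apply: contraT => Fsw.
  have ui i : u 0 i <= \sum_i `|u 0 i|.
    by rewrite (le_trans (ler_norm _)) // (bigD1 i) //= lerDl sumr_ge0.
  have [sA wA] : s \in A /\ w \in A.
    split; rewrite in_fset_set ?in_setE /=; try exact: box_finite.
      move=> i; have := ui i; have [] := F0 i Fsw; rewrite !mxE.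
      by move: (\sum_i _) (s 0 i) (w 0 i) (u 0 i) a0 => ? ? ? ?; clear; lia.
    move=> i; have := ui i; have [] := F0 i Fsw; rewrite !mxE.
    by move: (\sum_i _) (s 0 i) (w 0 i) (u 0 i) a0 => ? ? ? ?; clear; lia.
  by move: sw; rewrite sA wA => -[].
transitivity (\sum_(w \in [set: 'rV[int]_n]) \sum_(s \in [set: 'rV[int]_n]) F s w).
  rewrite (@fsumT_supp _ A); last by move=> s sA; apply: fsbig1 => w _; apply: FA; left.
  rewrite [RHS](@fsumT_supp _ A); last by move=> w wA; apply: fsbig1 => s _; apply: FA; right.
  rewrite (eq_bigr (fun s => \sum_(w <- A) F s w)); last first.
    by move=> s _; apply: fsumT_supp => w wA; apply: FA; right.
  rewrite [RHS](eq_bigr (fun w => \sum_(s <- A) F s w)); last first.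
    by move=> w _; apply: fsumT_supp => s sA; apply: FA; left.
  exact: exchange_big.
apply: eq_fsbigr => w _ /=; rewrite /mul_coef mulr_fsuml mulr_fsumr.
by apply: eq_fsbigr => s _; rewrite /F; ring.
Qed.

Let oner_neq0' : monomial 0 != laurent_zero.
Proof.
apply/eqP => /(congr1 (fun f : L => f 0))/eqP.
by rewrite /= eqxx oner_eq0.
Qed.

HB.instance Definition _ := GRing.Zmodule_isNzRing.Build L
  mulA mul1 mulr1' mulDl mulDr oner_neq0'.

Let scalerAl' (a : k) f g : a *: (f * g) = (a *: f) * g.
Proof.
apply: laurentP => u /=; rewrite /mul_coef mulr_fsumr.
by apply: eq_fsbigr => s _ /=; ring.
Qed.

HB.instance Definition _ := GRing.Lmodule_isLalgebra.Build k L scalerAl'.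

Let scalerAr' (a : k) f g : a *: (f * g) = f * (a *: g).
Proof.
apply: laurentP => u /=; rewrite /mul_coef mulr_fsumr.
by apply: eq_fsbigr => s _ /=; ring.
Qed.

HB.instance Definition _ := GRing.Lalgebra_isAlgebra.Build k L scalerAr'.

Lemma monomial0 : monomial 0 = 1 :> L.
Proof. by []. Qed.

Lemma monomialM s t :
  monomial s * monomial t = mono_twist s t *: monomial (s + t).
Proof.
apply: laurentP => u /=; rewrite /mul_coef (@fsumT_only _ s) => [|v /negPf vs].
  rewrite /= eqxx mul1r [s + t]addrC -subr_eq.
  by case: eqP => [->//|_]; rewrite !mulr0.
by rewrite /= vs mul0r mulr0.
Qed.

Definition laurentX (i : 'I_n) : L := monomial (delta_mx 0 i).

Lemma laurentX_comm i j :
  laurentX i * laurentX j = q i j *: (laurentX j * laurentX i).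
Proof.
have twistX (a b : 'I_n) : mono_twist (delta_mx 0 a) (delta_mx 0 b) =
    if (b < a)%N then q a b else 1.
  rewrite /mono_twist (bigD1 a) //= [X in _ * X]big1 => [|c ca]; last first.
    by rewrite big1 // => d _; rewrite !mxE (negPf ca) mul0r expr0z.
  rewrite mulr1; case: ifPn => ba.
    rewrite (bigD1 b) //= big1 => [|d /andP[_ db]].
      by rewrite !mxE !eqxx /= ?mulr1 expr1z ?mulr1.
    by rewrite !mxE (negPf db) andbF mulr0 expr0z.
  rewrite big1 // => d da; rewrite !mxE eqxx [d == b]negbTE ?mulr0 ?expr0z //.
  by apply: contraNneq ba => <-.
rewrite /laurentX !monomialM !twistX addrC scalerA; congr (_ *: _).
case: (ltngtP i j) => [ij|ji|/val_inj->].
- by have [qij ->] := hq.2 i j; have [qji _] := hq.2 j i; rewrite mulVf.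
- by rewrite mulr1.
- by rewrite hq.1 mulr1.
Qed.

Lemma monomial_prod (m : 'I_n -> nat) :
  monomial (\row_i (m i)%:Z) = \prod_i laurentX i ^+ m i.
Proof.
have monoX i e : laurentX i ^+ e = monomial (delta_mx 0 i *+ e).
  elim: e => [|e IH]; first by rewrite expr0 mulr0n.
  rewrite exprS IH monomialM -mulrS [mono_twist _ _]big1 ?scale1r // => a _.
  rewrite big1 // => b ba; rewrite mulmxnE !mxE /=.
  case: (a =P i) => [ai|_]; last by rewrite mul0r expr0z.
  case: (b =P i) => [bi|_]; last by rewrite mul0rn mulr0 expr0z.
  by move: ba; rewrite ai bi ltnn.
have -> : \row_i (m i)%:Z = \sum_i delta_mx 0 i *+ m i :> 'rV[int]_n.
  apply/rowP => j; rewrite mxE summxE (bigD1 j) //= big1 => [|i ij].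
    by rewrite mulmxnE mxE !eqxx addr0 -natz.
  by rewrite mulmxnE mxE [j == i]eq_sym (negPf ij) mul0rn.
have : sorted ltn (map val (index_enum 'I_n)).
  by rewrite -[index_enum _]enumT val_enum_ord iota_ltn_sorted.
elim: (index_enum _) => [|i r IH] /=; first by rewrite !big_nil.
rewrite (path_sortedE ltn_trans) => /andP[ir sr].
rewrite !big_cons -IH // monoX monomialM [mono_twist _ _]big1 ?scale1r // => a _.
rewrite big1 // => b ba; rewrite mulmxnE !mxE.
case: (a =P i) => [ai|_]; last by rewrite mul0rn mul0r expr0z.
rewrite summxE big_seq big1 ?mulr0 ?expr0z // => c cr.
rewrite mulmxnE mxE [b == c]negbTE ?mul0rn //; apply: contraTneq ba => ->.
by rewrite ai -leqNgt ltnW //; move/allP: ir; apply; apply: map_f.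
Qed.

End LaurentRing.

Definition torus (k : fieldType) (n : nat) :=
  {h : 'rV[k]_n | forall i, h 0 i != 0}.

Section TorusAction.
Context {k : fieldType} {n : nat} {q : 'M[k]_n} {hq : mult_antisymmetric q}.
Notation L := (laurent hq).
Implicit Types (h : torus k n) (f g : L) (s t : 'rV[int]_n).

Definition weight h s : k := \prod_i sval h 0 i ^ s 0 i.

Lemma weightD h s t : weight h (s + t) = weight h s * weight h t.
Proof.
rewrite -big_split; apply: eq_bigr => i _; rewrite mxE expfzDr //.
exact: (svalP h i).
Qed.

Lemma weight0 h : weight h 0 = 1.
Proof. by rewrite /weight big1 // => i _; rewrite mxE expr0z. Qed.

Let torus_act_bounded h f : exists m : int, forall s (i : 'I_n),
  s 0 i < m -> (fun s => weight h s * f s) s = 0.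
Proof.
by have [m fm] := coef_bounded f; exists m => s i /fm ->; rewrite mulr0.
Qed.
Definition torus_act h f : L := Laurent hq (torus_act_bounded h f).

Lemma torus_act_monomial h s :
  torus_act h (monomial s) = weight h s *: monomial s.
Proof.
apply: laurentP => t /=; case: (t =P s) => [->//|_]; by rewrite !mulr0.
Qed.

Let torus_act_is_linear h : linear (torus_act h).
Proof. by move=> a f g; apply: laurentP => s /=; ring. Qed.

HB.instance Definition _ h :=
  GRing.isLinear.Build k L L _ (torus_act h) (torus_act_is_linear h).

Let torus_act_is_monoid_morphism h : monoid_morphism (torus_act h).
Proof.
split.
  by rewrite -[1]monomial0 torus_act_monomial weight0 scale1r.
move=> f g; apply: laurentP => u /=; rewrite /mul_coef mulr_fsumr.
apply: eq_fsbigr => s _ /=.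
have -> : weight h u = weight h (u - s) * weight h s by rewrite -weightD subrK.
by ring.
Qed.

HB.instance Definition _ h :=
  GRing.isMonoidMorphism.Build L L (torus_act h) (torus_act_is_monoid_morphism h).

Lemma torus_act_bij h : bijective (torus_act h).
Proof.
have hV i : (\row_i (sval h 0 i)^-1) 0 i != 0 :> k.
  by rewrite mxE invr_eq0; apply: (svalP h).
pose h' : torus k n := exist _ _ hV.
have ww s : weight h s * weight h' s = 1.
  rewrite -big_split big1 // => i _ /=; rewrite mxE exprz_inv -exprzDr ?unitfE.
    by rewrite subrr expr0z.
  exact: (svalP h).
exists (torus_act h') => f; apply: laurentP => s /=; rewrite mulrA.
  by rewrite [weight h' s * _]mulrC ww mul1r.
by rewrite ww mul1r.
Qed.

Definition torus_act_spec h (P : spec L) : spec L :=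
  Spec (prime_ideal_image (torus_act_bij h) (specP P)).

Definition torus_orbit (P : spec L) : set (spec L) :=
  range (fun h => torus_act_spec h P).

End TorusAction.

(* Main.v *)
(** Let M be a left ideal of L stable under the torus and f a nonzero element of M.
    By Dickson's lemma the support of f has a finite subset S such that every
    exponent of f is componentwise above one in S. As k is infinite, the operators
    h - w(h, s), with w(h, s) the weight of x^s, kill prescribed exponents of S and
    keep others, so M contains, for each s in S, an element x^s + g where every
    exponent of g lies strictly above one in S. Thus x^s lies in
    M + sum_(t in S) m x^t with m the maximal ideal of the power series ring, and by
    Nakayama's lemma x^s is in M; being a unit, it forces M = L.
    Both claims follow: the intersection of an orbit of primes is stable and proper,
    and so is the Jacobson radical, as automorphisms permute maximal left ideals. *)
Require Import Defs.
From mathcomp Require Import all_boot all_order all_algebra finmap.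
From mathcomp Require Import all_classical topology.

Local Open Scope classical_set_scope.
Local Open Scope ring_scope.

(** * Maximal left ideals and a noncommutative Nakayama lemma *)

Section LeftIdeals.
Set Implicit Arguments.
Unset Strict Implicit.
Import GRing.Theory.
Context {R : nzRingType}.
Implicit Types (M I : set R).

Lemma left_ideal1 M : left_ideal M -> M 1 -> M = setT.
Proof.
move=> [_ _ MM] M1; apply/seteqP; split=> // x _.
by rewrite -[x]mulr1; apply: MM.
Qed.

Lemma ex_maximal_left_ideal : exists M, maximal_left_ideal M.
Proof.
(* [0 \in X] is left out of [P] so that the union of the empty chain satisfies it. *)
pose P (X : set R) := [/\ ~ X 1, forall a b, X a -> X b -> X (a + b) &
  forall r a, X a -> X (r * a)].
have [F FP totF|M [[M1 MD MM] maxM]] := @Zorn_bigcup _ P.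
  split.
  - by move=> [X /FP[]].
  - move=> a b [X FX Xa] [Y FY Yb].
    case: (totF _ _ FX FY) => [XY|YX].
      by exists Y => //; case: (FP _ FY) => _ + _; apply=> //; apply: XY.
    by exists X => //; case: (FP _ FX) => _ + _; apply=> //; apply: YX.
  - by move=> r a [X FX Xa]; exists X => //; case: (FP _ FX) => _ _; apply.
(* If $0\notin M$ then $M$ is empty, since $0=0\cdot a$, and [[set 0]] is strictly larger. *)
have M0 : M 0.
  apply: contrapT => nM0; apply: (maxM [set 0]).
    split=> [a Ma /=|]; last by move=> /(_ 0 erefl).
    by case: nM0; rewrite -(mul0r a); apply: MM.
  split=> /=; first by apply/eqP/oner_neq0.
    by move=> _ _ -> ->; rewrite addr0.
  by move=> r _ ->; rewrite mulr0.
exists M; split=> [||I Il MI]; first by [].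
  by move=> MT; apply: M1; rewrite MT.
have [I1|nI1] := pselect (I 1); first by right; apply: left_ideal1.
left; apply: contrapT => IM; case: (Il) => I0 ID IMul.
by apply: (maxM I) => //; split=> // sIM; apply: IM; apply/seteqP; split.
Qed.

Lemma maximal_left_ideal_preimage (f : {rmorphism R -> R}) M :
  bijective f -> maximal_left_ideal M -> maximal_left_ideal (f @^-1` M).
Proof.
case=> g fg gf [[M0 MD MM] MT maxM].
split; first split; rewrite /preimage /=.
- by rewrite rmorph0.
- by move=> a b; rewrite rmorphD; apply: MD.
- by move=> r a; rewrite rmorphM; apply: MM.
- move=> fT; apply: MT; apply/seteqP; split=> // x _; rewrite -(gf x).
  by have : [set x | M (f x)] (g x) by rewrite fT.
move=> I [I0 ID IM] sMI.
(* [g] is a bare inverse function: its additivity and multiplicativity come from the injectivity of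
   [f]. *)
have gl : left_ideal (g @^-1` I).
  split; rewrite /preimage /=.
  - by rewrite -(rmorph0 f) fg.
  - move=> a b Ia Ib; have -> : g (a + b) = g a + g b; last exact: ID.
    by apply: (can_inj fg); rewrite rmorphD !gf.
  - move=> r a Ia; have -> : g (r * a) = g r * g a; last exact: IM.
    by apply: (can_inj fg); rewrite rmorphM !gf.
have sMg : M `<=` g @^-1` I by move=> x Mx; apply: sMI; rewrite /= gf.
have [E|E] := maxM _ gl sMg; [left|right]; apply/seteqP; split=> // x.
- by move=> Ix /=; rewrite -E /preimage /= fg.
- by move=> _; rewrite -(fg x); have : (g @^-1` I) (f x) by rewrite E.
Qed.

Section Nakayama.
Variables (M A m : set R).
Hypotheses (Ml : left_ideal M) (mD : forall a b, m a -> m b -> m (a + b))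
  (Am : forall a b, A a -> m b -> m (a * b)) (mA : m `<=` A)
  (m_inv : forall a, m a -> exists2 u, A u & u * (1 - a) = 1).

(** This is $M+\sum_{x\in l} m x$. Here [A] stands for the power series ring and [m] for its maximal
    ideal; [m_inv] is the Jacobson radical property that Nakayama's lemma requires. *)
Fixpoint combs (l : seq R) : set R :=
  if l is x :: l' then [set y | exists a z, [/\ m a, combs l' z & y = a * x + z]]
  else M.

Lemma combsD l x y : combs l x -> combs l y -> combs l (x + y).
Proof.
case: Ml => _ MD _; elim: l x y => [|t l IH] //= x y.
move=> [a [z [ma lz ->]]] [b [w [mb lw ->]]]; exists (a + b), (z + w).
by rewrite mulrDl addrACA; split; [apply: mD|apply: IH|].
Qed.

Lemma combsM l a x : A a -> combs l x -> combs l (a * x).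
Proof.
case: Ml => _ _ MM Aa; elim: l x => [|t l IH] /= x; first exact: MM.
move=> [b [z [mb lz ->]]]; exists (a * b), (a * z).
by rewrite mulrDr mulrA; split; [apply: Am|apply: IH|].
Qed.

(** Elimination of one generator at a time: $x=ax+z$ gives $x=(1-a)^{-1}z$, which is substituted
    into the other relations before inducting. *)
Lemma nakayama l : (forall x, x \in l -> combs l x) -> forall x, x \in l -> M x.
Proof.
elim: l => [|x l IH] //= lW.
have lx : combs l x.
  have [a [z [ma lz xE]]] := lW x (mem_head _ _).
  have [u Au u1] := m_inv ma.
  have -> : x = u * z; last exact: combsM.
  by rewrite -[LHS]mul1r -u1 -mulrA mulrBl mul1r {1}xE [a * x + z]addrC addrK.
have Ml' : forall y, y \in l -> M y.
  apply: IH => y yl.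
  have [|a [z [ma lz ->]]] := lW y; first by rewrite in_cons yl orbT.
  by apply: combsD => //; apply: combsM => //; apply: mA.
have sub l' : {subset l' <= l} -> combs l' `<=` M.
  case: Ml => _ MD MM; elim: l' => [|t l' IHl] /= sl y; first by [].
  move=> [a [z [ma lz ->]]].
  apply: MD; first by apply: MM; apply: Ml'; rewrite sl ?mem_head.
  by apply: IHl lz => w wl; rewrite sl // in_cons wl orbT.
by move=> y; rewrite in_cons => /predU1P[->|/Ml'//]; apply: sub lx.
Qed.

End Nakayama.
End LeftIdeals.

(** * Dickson's lemma for exponents, and powers in an infinite field *)

Section Exponents.
Set Implicit Arguments.
Unset Strict Implicit.
Import Order.TTheory GRing.Theory Num.Theory.

(* Dickson's lemma, by induction on the coordinates to be compared: beyond the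
   largest i-th coordinate met so far, i comes for free; below it, i takes
   finitely many values. *)
Lemma dickson n (m : int) (D : seq 'I_n) (A : set 'rV[int]_n) :
  (forall s, A s -> forall i, m <= s 0 i) ->
  exists S : seq 'rV[int]_n, (forall s, s \in S -> A s) /\
    forall t, A t -> exists2 s, s \in S & forall i, i \in D -> s 0 i <= t 0 i.
Proof.
elim: D A => [|i D IH] A Am.
  have [[t At]|nA] := pselect (exists t, A t).
    by exists [:: t]; split=> [s|s _]; [rewrite inE => /eqP->|exists t; rewrite ?inE].
  by exists [::]; split=> // t At; case: nA; exists t.
have [S0 [S0A S0t]] := IH A Am.
have Av_m v s : (A `&` [set s | s 0 i = m + v%:Z]) s -> forall i, m <= s 0 i.
  by move=> [/Am].
have /choice[Sv Svp] v := IH _ (Av_m v).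
(* A sum replaces the maximum: $m+N$ bounds $s_i$ for every $s$ in [S0]. *)
pose N := (\sum_(s <- S0) absz (s 0 i - m)%R)%N.
exists (S0 ++ flatten [seq Sv v | v <- iota 0 N]); split=> [s|t At].
  rewrite mem_cat => /orP[/S0A//|/flatten_mapP[v _]].
  by case: (Svp v) => + _ => /[apply] -[].
have [tN|tN] := leP (m + N%:Z) (t 0 i).
  have [s sS st] := S0t t At; exists s; first by rewrite mem_cat sS.
  move=> j; rewrite in_cons => /predU1P[->|/st//]; apply: le_trans tN.
  rewrite -lerBlDl (le_trans (ler_norm _)) // -abszE lez_nat /N.
  by rewrite (big_rem s) //= leq_addr.
have mt := Am t At i.
case: (Svp (absz (t 0 i - m)%R)) => _ /(_ t); case.
  by split=> //=; rewrite gez0_abs ?subr_ge0 // addrC subrK.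
move=> s sS st; exists s.
  rewrite mem_cat; apply/orP; right; apply/flatten_mapP.
  exists (absz (t 0 i - m)%R) => //; rewrite mem_iota /= add0n.
  by rewrite -ltz_nat gez0_abs ?subr_ge0 // ltrBlDl.
move=> j; rewrite in_cons => /predU1P[->|/st//].
case: (Svp (absz (t 0 i - m)%R)) => /(_ s sS)[_ /= ->] _.
by rewrite gez0_abs ?subr_ge0 // addrC subrK.
Qed.

(** Otherwise every element of $k$ would be a root of the nonzero polynomial $X(X^{|d|}-1)$. *)
Lemma infinite_field_expz (k : fieldType) (d : int) :
  infinite_set [set: k] -> d != 0 -> exists2 t : k, t != 0 & t ^ d != 1.
Proof.
move=> kinf d0; apply: contrapT => no.
have td (t : k) : t != 0 -> t ^+ `|d| = 1.
  move=> t0; have td : t ^ d = 1.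
    by apply/eqP; apply: contraT => ?; case: no; exists t.
  case: d {no d0} td => e //= /(congr1 (@GRing.inv k)).
  by rewrite NegzE /= -exprnN invrK invr1.
pose p : {poly k} := 'X * ('X^`|d| - 1).
have p0 : p != 0.
  by rewrite mulf_neq0 ?polyX_eq0 // -size_poly_gt0 size_XnsubC // absz_gt0.
have [B _ Bp] := infinite_set_fset (size p) kinf.
have := max_poly_roots (rs := enum_fset B) p0; rewrite fset_uniq => /(_ _ isT).
rewrite ltnNge Bp => H; suff /H : all (root p) B by [].
apply/allP => t _; rewrite rootE /p !hornerE.
by have [->|/td->] := eqVneq t 0; rewrite ?mul0r // subrr mulr0.
Qed.

End Exponents.

(** * The order filtration, geometric series and invertible monomials *)

Section LaurentUnits.
Set Implicit Arguments.
Unset Strict Implicit.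
Import Order.TTheory GRing.Theory Num.Theory.
Context {k : fieldType} {n : nat} {q : 'M[k]_n} {hq : mult_antisymmetric q}.
Notation L := (laurent hq).
Implicit Types (a f g u : L) (s t : 'rV[int]_n) (N : nat).

Lemma coef_mul_neq0 f g t :
  (f * g) t != 0 -> exists2 s, f s != 0 & g (t - s) != 0.
Proof.
move=> fg; apply: contrapT => no; case/eqP: fg; apply: fsbig1 => s _.
have [->|fs] := eqVneq (f s) 0; first by rewrite mul0r mulr0.
have [->|gs] := eqVneq (g (t - s)) 0; first by rewrite !mulr0.
by case: no; exists s.
Qed.

(* [ord_ge 0] is the power series ring R and [ord_ge 1] its maximal ideal. *)
Definition ord_ge N : set L := [set f | forall s, f s != 0 ->
  (forall i, 0 <= s 0 i) /\ N%:Z <= \sum_i s 0 i].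

Lemma ord_geD N f g : ord_ge N f -> ord_ge N g -> ord_ge N (f + g).
Proof.
move=> fN gN s /= fgs; have [f0|/fN//] := eqVneq (f s) 0.
by apply: gN; move: fgs; rewrite f0 add0r.
Qed.

Lemma ord_geN N f : ord_ge N f -> ord_ge N (- f).
Proof. by move=> fN s /=; rewrite oppr_eq0; apply: fN. Qed.

Lemma ord_geM N N' f g : ord_ge N f -> ord_ge N' g -> ord_ge (N + N') (f * g).
Proof.
move=> fN gN t /coef_mul_neq0[s /fN[s0 sN] /gN[ts0 tsN]].
have tE i : t 0 i = s 0 i + (t - s) 0 i by rewrite !mxE addrCA subrr addr0.
split=> [i|]; first by rewrite tE addr_ge0.
by rewrite (eq_bigr _ (fun i _ => tE i)) big_split PoszD lerD.
Qed.

Lemma ord_ge0 N : ord_ge N 0.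
Proof. by move=> s; rewrite /= eqxx. Qed.

Lemma ord_ge1 : ord_ge 0 1.
Proof.
move=> s; rewrite -[1]monomial0 /=; have [->|] := eqVneq s 0; last by rewrite eqxx.
by split=> [i|]; [rewrite mxE|rewrite sumr_ge0 // => i _; rewrite mxE].
Qed.

Lemma ord_geW N f : ord_ge N f -> ord_ge 0 f.
Proof. by move=> fN s /fN[s0 _]; split=> //; apply: sumr_ge0 => i _. Qed.

Lemma ord_ge_coef0 N f s : ord_ge N f -> \sum_i s 0 i < N%:Z -> f s = 0.
Proof.
move=> fN sN; apply/eqP; apply: contraT => /fN[_].
by rewrite leNgt sN.
Qed.

Lemma ord_geX a N : ord_ge 1 a -> ord_ge N (a ^+ N).
Proof.
move=> a1; elim: N => [|N IH]; first by rewrite expr0; apply: ord_ge1.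
by rewrite exprS -add1n; apply: ord_geM.
Qed.

(** The inverse is the geometric series $\sum_j a^j$. Since $a^j$ has order at least $j$, each
    coefficient is already that of a long enough partial sum. *)
Lemma ord_ge1_inv a : ord_ge 1 a -> exists2 u, ord_ge 0 u & u * (1 - a) = 1.
Proof.
move=> a1; pose U N := \sum_(j < N) a ^+ j.
have U0 N : ord_ge 0 (U N).
  rewrite /U; elim/big_ind: _ => [|x y|j _]; [exact: ord_ge0|exact: ord_geD|].
  exact: ord_geW (ord_geX a1).
have Ustab N N' s : (N <= N')%N -> \sum_i s 0 i < N%:Z -> U N' s = U N s.
  move=> /subnK <- sN; elim: (N' - N)%N => // d IH.
  rewrite addSn /U big_ord_recr /= -/(U _) IH (ord_ge_coef0 (ord_geX a1)) ?addr0 //.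
  by rewrite (lt_le_trans sN) // lez_nat leq_addl.
have UE N : U N * (1 - a) = 1 - a ^+ N.
  elim: N => [|N IH]; first by rewrite /U big_ord0 mul0r expr0 subrr.
  by rewrite /U big_ord_recr /= -/(U N) mulrDl IH mulrBr mulr1 -exprSr addrA subrK.
(* A natural number strictly above the total degree of $s$: from [D s] terms on, the coefficient at
   $s$ is stable. *)
pose D s := (absz (\sum_i s 0 i)%R).+1.
have DP s : \sum_i s 0 i < (D s)%:Z.
  by rewrite (le_lt_trans (ler_norm _)) // -abszE ltz_nat.
have ub : exists m : int, forall s (i : 'I_n), s 0 i < m -> U (D s) s = 0.
  exists 0 => s i; rewrite ltNge; apply: contraNeq => /U0[+ _]; exact.
pose u : L := Laurent hq ub.
have u0 : ord_ge 0 u by move=> s /U0.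
exists u => //; apply: laurentP => t.
have uU : ord_ge (D t) (u - U (D t)).
  move=> s; have [Ds|Ds] := ltP (\sum_i s 0 i) (D t)%:Z.
    suff UE' : U (D s) s = U (D t) s by rewrite /= UE' subrr eqxx.
    by case: (leqP (D t) (D s)) => [|/ltnW] /Ustab ->.
  move=> dns; suff /(_ s dns)[] : ord_ge 0 (u - U (D t)) by [].
  by apply: ord_geD => //; apply: ord_geN.
have uUa : ord_ge (D t) ((u - U (D t)) * (1 - a)).
  suff /(ord_geM uU) : ord_ge 0 (1 - a) by rewrite addn0.
  by apply: ord_geD; [exact: ord_ge1|apply: ord_geN; apply: ord_geW a1].
(* The first two terms have order at least [D t], so they vanish at $t$. *)
have -> : u * (1 - a) = (u - U (D t)) * (1 - a) - a ^+ D t + 1.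
  by rewrite -addrA [- _ + 1]addrC -UE -mulrDl subrK.
rewrite -[LHS]/(((u - U (D t)) * (1 - a)) t - (a ^+ D t) t + (1 : L) t).
by rewrite (ord_ge_coef0 uUa) // (ord_ge_coef0 (ord_geX (N := D t) a1)) // subrr add0r.
Qed.

(** By bimultiplicativity its product with [mono_twist s s] is [mono_twist 0 s], which is $1$. Hence
    a multiple of $x^{-s}$ inverts $x^s$. *)
Lemma mono_twistV s : mono_twist (q := q) (- s) s != 0.
Proof.
apply/eqP => tw0; have /eqP := mono_twistDl (hq := hq) (- s) s s.
by rewrite addNr mono_twist0l tw0 mul0r oner_eq0.
Qed.

Lemma left_ideal_monomial (M : set L) s : left_ideal M -> M (monomial s) -> M = setT.
Proof.
move=> Ml Ms; apply: left_ideal1 => //; case: Ml => _ _ MM.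
have -> : 1 = ((mono_twist (q := q) (- s) s)^-1 *: monomial (- s)) * monomial s :> L.
  by rewrite -scalerAl monomialM scalerA mulVf ?mono_twistV // scale1r addNr monomial0.
exact: MM.
Qed.

(** Each exponent of $g$ is assigned to the first $s$ in $S$ strictly below it. The part of $g$
    assigned to $s$ is a left multiple of $x^s$ whose cofactor has order at least $1$. *)
Lemma combs_monomial (M : set L) (S : seq 'rV[int]_n) g : M 0 ->
  (forall t, g t != 0 -> exists2 s, s \in S & t != s /\ forall i, s 0 i <= t 0 i) ->
  combs M (ord_ge 1) [seq monomial s | s <- S] g.
Proof.
move=> M0; elim: S g => [|s S IH] g gS.
  have -> : g = 0; last by [].
  by apply: laurentP => t; apply/eqP; apply: contraT => /gS[].
pose p t := (t != s) && [forall i, s 0 i <= t 0 i].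
have rb (b : bool) : exists m : int, forall t (i : 'I_n),
    t 0 i < m -> (if p t == b then g t else 0) = 0.
  by have [m gm] := coef_bounded g; exists m => t i /gm ->; rewrite if_same.
pose g1 : L := Laurent hq (rb true); pose g2 : L := Laurent hq (rb false).
have g1p t : g1 t != 0 -> p t by rewrite /g1 /=; case: (p t); rewrite //= eqxx.
exists ((mono_twist (q := q) (- s) s)^-1 *: (g1 * monomial (- s))), g2; split.
- move=> u; rewrite /= mulf_eq0 negb_or => /andP[_] /coef_mul_neq0[t].
  move=> /g1p/andP[ts /forallP st] /=.
  case: (u - t =P - s) => [uts _|_]; last by rewrite eqxx.
  have uE : u = t - s by rewrite -uts addrCA subrr addr0.
  have u_ge0 i : 0 <= u 0 i by rewrite uE !mxE subr_ge0.
  split=> //; rewrite -gtz0_ge1 lt_neqAle sumr_ge0 // andbT eq_sym.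
  (* A nonnegative exponent of total degree $0$ is $0$, which would give $t=s$. *)
  apply: contra ts => /eqP/psumr_eq0P u0; rewrite -subr_eq0 -uE.
  by apply/eqP/rowP => i; rewrite u0 // mxE.
- apply: IH => t /=; case: (p t =P false) => [pt|_]; last by rewrite eqxx.
  move=> /gS[r]; rewrite in_cons => /predU1P[->|rS] rt; last by exists r.
  by case: rt => ts /forallP st; rewrite /p ts st in pt.
- rewrite -scalerAl -mulrA monomialM -scalerAr scalerA mulVf ?mono_twistV //.
  rewrite scale1r addNr monomial0 mulr1; apply: laurentP => t /=.
  by case: (p t); rewrite ?addr0 ?add0r.
Qed.

End LaurentUnits.

(** * Torus-stable left ideals, dense orbits and the Jacobson radical *)

Section Torus.
Set Implicit Arguments.
Unset Strict Implicit.
Import Order.TTheory GRing.Theory Num.Theory.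
Context {k : fieldType} {n : nat} {q : 'M[k]_n} {hq : mult_antisymmetric q}.
Notation L := (laurent hq).
Implicit Types (h : torus k n) (f g : L) (s t : 'rV[int]_n) (M : set L).

(** A torus element with a single nontrivial coordinate suffices, placed where $s$ and $t$
    differ. *)
Lemma weight_separation s t : infinite_set [set: k] -> s != t ->
  exists h : torus k n, weight h s != weight h t.
Proof.
move=> kinf st; have [i sti] : exists i, s 0 i != t 0 i.
  by apply/existsP; apply: contraR st; rewrite negb_exists => /forallP st;
     apply/eqP/rowP => i; apply/eqP; have := st i; rewrite negbK.
have [x x0 xd] : exists2 x : k, x != 0 & x ^ (s 0 i - t 0 i) != 1.
  by apply: infinite_field_expz; rewrite ?subr_eq0.
have hP j : (\row_j (if j == i then x else 1)) 0 j != 0 :> k.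
  by rewrite mxE; case: ifP; rewrite ?oner_eq0.
exists (exist _ _ hP).
have wE r : weight (exist _ _ hP) r = x ^ r 0 i.
  rewrite /weight (bigD1 i) //= big1 => [|j /negPf ji]; rewrite mxE ?eqxx ?mulr1 //.
  by rewrite ji exp1rz.
apply: contra xd; rewrite !wE => /eqP xst.
by rewrite expfzDr // xst -expfzDr // subrr expr0z.
Qed.

(** The group laws of $H$ are needed only through the action; this and the next two lemmas provide
    product, inverse and unit, taken coordinatewise. *)
Lemma torus_mul h1 h2 : exists h, forall f, torus_act h f = torus_act h1 (torus_act h2 f).
Proof.
have hP i : (\row_i (sval h1 0 i * sval h2 0 i)) 0 i != 0 :> k.
  by rewrite mxE mulf_neq0 //; [apply: (svalP h1)|apply: (svalP h2)].
exists (exist _ _ hP) => f; apply: laurentP => s /=; rewrite mulrA -big_split.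
by congr (_ * _); apply: eq_bigr => i _; rewrite /= mxE expfzMl.
Qed.

Lemma torus_inv h : exists h', forall f, torus_act h' (torus_act h f) = f.
Proof.
have hP i : (\row_i (sval h 0 i)^-1) 0 i != 0 :> k.
  by rewrite mxE invr_eq0; apply: (svalP h).
exists (exist _ _ hP) => f; apply: laurentP => s /=; rewrite mulrA -big_split.
rewrite big1 ?mul1r // => i _; rewrite /= mxE -expfzMl mulVf ?exp1rz //.
exact: (svalP h).
Qed.

Lemma torus_id : exists h, forall f, torus_act h f = f.
Proof.
have hP i : (const_mx 1 : 'rV[k]_n) 0 i != 0 by rewrite mxE oner_eq0.
exists (exist _ _ hP) => f; apply: laurentP => s /=.
by rewrite /weight big1 ?mul1r // => i _; rewrite mxE exp1rz.
Qed.

Lemma torus_stable_isolate M (S : seq 'rV[int]_n) f t :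
  infinite_set [set: k] -> left_ideal M -> (forall h g, M g -> M (torus_act h g)) ->
  M f -> f t != 0 ->
  exists g, [/\ M g, forall s, g s != 0 -> f s != 0, g t = 1 &
    forall s, s \in S -> s != t -> g s = 0].
Proof.
move=> kinf [_ MD MM] Mh Mf ft.
have MZ c g : M g -> M (c *: g) by rewrite -[g in _ *: g]mul1r scalerAl; apply: MM.
(* The induction only keeps the coefficient at $t$ nonzero; one rescaling at the end makes it
   $1$. *)
suff [g [Mg gf gt gS]] : exists g, [/\ M g, forall s, g s != 0 -> f s != 0,
    g t != 0 & forall s, s \in S -> s != t -> g s = 0].
  exists ((g t)^-1 *: g); split=> [|s /=|/=|s sS st /=].
  - exact: MZ.
  - by rewrite mulf_eq0 negb_or => /andP[_ /gf].
  - by rewrite mulVf.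
  - by rewrite (gS s sS st) ?mulr0.
elim: S => [|r S [g [Mg gf gt gS]]]; first by exists f.
have [->|rt] := eqVneq r t.
  exists g; split=> // s; rewrite in_cons => /predU1P[->|]; last exact: gS.
  by rewrite eqxx.
have [h hrt] := weight_separation kinf rt.
have gE s : (torus_act h g - weight h r *: g) s = (weight h s - weight h r) * g s.
  by rewrite /= mulrBl.
(* This acts diagonally on coefficients: it kills the one at $r$, keeps the one at $t$ nonzero and
   never enlarges the support. *)
exists (torus_act h g - weight h r *: g); split.
- by apply: MD; [apply: Mh|rewrite -scaleNr; apply: MZ].
- by move=> s; rewrite gE mulf_eq0 negb_or => /andP[_ /gf].
- by rewrite gE mulf_neq0 // subr_eq0 eq_sym.
- move=> s; rewrite in_cons gE => /predU1P[->|sS] st; first by rewrite subrr mul0r.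
  by rewrite gS // mulr0.
Qed.

Lemma torus_stable_left_ideal M f : infinite_set [set: k] -> left_ideal M ->
  (forall h g, M g -> M (torus_act h g)) -> M f -> f != 0 -> M = setT.
Proof.
move=> kinf Ml Mh Mf f0.
have [t ft] : exists t, f t != 0.
  apply: contrapT => no; case/eqP: f0; apply: laurentP => t.
  by apply/eqP; apply: contraT => ft; case: no; exists t.
have [m fm] := coef_bounded f.
have [|S [Sf St]] := @dickson n m (enum 'I_n) [set s | f s != 0].
  by move=> s fs i; rewrite leNgt; apply: contraNN fs => /fm ->.
have [s sS _] := St t ft.
apply: (@left_ideal_monomial _ _ _ _ _ s) => //.
apply: (@nakayama _ M (ord_ge 0) (ord_ge 1) _ _ _ _ _
  [seq monomial s | s <- S]); last exact: map_f.
- exact: Ml.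
- exact: ord_geD.
- by move=> a b; rewrite -[1%N]add0n; apply: ord_geM.
- by move=> a; apply: ord_geW.
- exact: ord_ge1_inv.
move=> _ /mapP[r rS ->].
have [g [Mg gf gr gS]] := torus_stable_isolate S kinf Ml Mh Mf (Sf r rS).
(* In $x^r=(x^r-g)+g$ the second term is in $M$. An exponent of the first lies above some $v\in S$,
   and differs from $v$ because $g$ vanishes on $S$ away from $r$. *)
rewrite -[monomial r](subrK g); apply: combsD => //.
- exact: ord_geD.
- apply: combs_monomial; first by case: Ml.
  move=> u; rewrite /=; have [->|ur] := eqVneq u r; first by rewrite gr subrr eqxx.
  rewrite sub0r oppr_eq0 => gu; have [v vS vu] := St u (gf u gu).
  exists v => //; split=> [|i]; last by rewrite vu // mem_enum.
  by apply: contraNneq gu => uv; rewrite gS // uv.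
- elim: [seq _ | _ <- _] => [|y l IH] //=; exists 0, g.
  by rewrite mul0r add0r; split=> //; apply: ord_ge0.
Qed.

Lemma torus_orbit_dense (P : spec L) : infinite_set [set: k] -> dense (torus_orbit P).
Proof.
move=> kinf O [Q OQ] [I Ii OE]; apply: contrapT => disj.
(* If $I=0$, every prime contains $I$ and the open set is empty. *)
have [f If f0] : exists2 f, I f & f != 0.
  apply: contrapT => no; move: OQ; rewrite OE; apply => f If.
  have -> : f = 0 by apply/eqP; apply: contraT => ?; case: no; exists f.
  by case: (specP Q) => -[[]].
have IP h : I `<=` torus_act_spec h P.
  apply: contrapT => nI; apply: disj; exists (torus_act_spec h P); split.
    by rewrite OE.
  by exists h.
have [[[P0 PD PM] _] PT _] := specP P.
(* The intersection of the orbit: $hg\in P$ means $g\in h^{-1}P$. *)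
pose M := [set g | forall h, spec_ideal P (torus_act h g)].
suff MT : M = setT.
  have [h1 h1E] := torus_id; apply: PT; apply/seteqP; split=> // x _.
  by rewrite -(h1E x); have : M x by rewrite MT.
apply: (@torus_stable_left_ideal M f) => //.
- split=> [h|g g' Mg Mg' h|r g Mg h].
  + by rewrite rmorph0.
  + by rewrite rmorphD; apply: PD; [exact: Mg|exact: Mg'].
  + by rewrite rmorphM; apply/PM/Mg.
- by move=> h g Mg h'; have [h2 <-] := torus_mul h' h.
- move=> h; have [h' h'E] := torus_inv h; case: (IP h' f If) => g Pg <-.
  (* [torus_inv] gives left inverses only; a left inverse of $h'$ shows that $h$ also undoes
     $h'$. *)
  have [h'' h''E] := torus_inv h'; have -> : torus_act h (torus_act h' g) = g; last by [].
  by rewrite -[RHS]h''E -[in RHS](h'E (torus_act h' g)) h''E.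
Qed.

Lemma jacobson_radical_laurent : infinite_set [set: k] -> jacobson_radical L = [set 0].
Proof.
move=> kinf; apply/seteqP; split=> [f Jf /=|_ -> M [[]]//].
(* A maximal left ideal exists, so the radical is proper. *)
apply/eqP; apply: contraT => f0; have [M Mmax] := @ex_maximal_left_ideal L.
case: (Mmax) => _ MT _; case: MT.
have : jacobson_radical L = setT.
  apply: (@torus_stable_left_ideal _ f) => //.
    split=> [K [[]]//|a b Ja Jb K Km|r a Ja K Km].
      by case: (Km) => -[_ + _] _ _; apply; [apply: Ja|apply: Jb].
    by case: (Km) => -[_ _ +] _ _; apply; apply: Ja.
  move=> h g Jg K Km.
  exact: (Jg _ (@maximal_left_ideal_preimage _ (torus_act h) K (torus_act_bij h) Km)).
move=> JT; apply/seteqP; split=> // x _.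
by have : jacobson_radical L x by [rewrite JT]; apply.
Qed.

End Torus.

Theorem corollary3p4 (k : fieldType) (n : nat) (q : 'M[k]_n)
    (hq : mult_antisymmetric q) :
  infinite_set [set: k] -> (1 <= n)%N ->
  (forall P : spec (laurent hq), dense (torus_orbit P)) /\
  jacobson_radical (laurent hq) = [set 0].
Proof.
move=> kinf _; split=> [P|]; first exact: torus_orbit_dense.
exact: jacobson_radical_laurent.
Qed.
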